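(* Let $G$ be a finite abelian group, and $H$ a non-trivial subgroup of $G$. Suppose that $|H|=k$ and $|G/H|=m$, and let $m_1,m_2,m_3$ be the numbers of cosets of $H$ in $G$ of Types 1, 2 and 3 respectively. (1) The clique number of the extended subgroup sum graph $\Gamma^+_{G,H}$ is equal to $k$, and its independence number is equal to $km_1/2+m_2+m_3$. (2) The clique number of the subgroup sum graph $\Gamma_{G,H}$ is $(k+s(H))/2$. (3) The independence number of the subgroup sum graph $\Gamma_{G,H}$ is equal to $km_1/2+2(m_2+m_3)$ if $s(H)<|H|$, and to $km_1/2+2m_2+m_3$ if $s(H)=|H|$.
   Context: Groups are written additively with identity $0$. A subgroup $H$ of $G$ is called trivial if $H=\{0\}$ or $H=G$, so non-trivial means $\{0\}\neq H\neq G$. For a finite abelian group $G$ and a subgroup $H$, the extended subgroup sum graph $\Gamma^+_{G,H}$ is the simple graph with vertex set $G$ in which distinct $x,y$ are adjacent iff $x+y\in H$; the subgroup sum graph $\Gamma_{G,H}$ is the simple graph with vertex set $G$ in which distinct $x,y$ are adjacent iff $x+y\in H\setminus\{0\}$. For a finite abelian group $X$, $s(X)$ is the number of $x\in X$ with $2x=0$. A coset $H+a$ of $H$ in $G$ has Type 1 if $2a\notin H$; Type 2 if $2a\in H$ but $H+a$ contains no solution of $2x=0$; Type 3 if $H+a$ contains a solution of $2x=0$. Thus $m_1+m_2+m_3=m$. The clique number is the maximum number of vertices in a complete subgraph, and the independence number is the maximum size of a set of pairwise non-adjacent vertices. *)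

(* Defs.v *)
From mathcomp Require Import all_boot all_order all_algebra all_fingroup.

Set Implicit Arguments.
Unset Strict Implicit.
Unset Printing Implicit Defensive.

Import GRing.Theory.
Local Open Scope ring_scope.

Record sgraph (T : finType) := SGraph {
  adj :> rel T;
  adj_sym : symmetric adj;
  adj_irrefl : irreflexive adj }.

Definition is_clique (T : finType) (e : sgraph T) (S : {set T}) : bool :=
  [forall x in S, forall y in S, (x != y) ==> e x y].

Definition is_independent (T : finType) (e : sgraph T) (S : {set T}) : bool :=
  [forall x in S, forall y in S, ~~ e x y].

Definition clique_number (T : finType) (e : sgraph T) : nat :=
  (\max_(S : {set T} | is_clique e S) #|S|)%N.

Definition independence_number (T : finType) (e : sgraph T) : nat :=
  (\max_(S : {set T} | is_independent e S) #|S|)%N.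

(* The canonical finGroupType structure of a finZmodType is its additive group,
   so H : {group G} is a subgroup of (G, +, 0), and H :* a is the coset H + a. *)
Section SubgroupSumGraphs.

Variables (G : finZmodType) (H : {group G}).
Implicit Types x y a : G.

Definition ext_sum_rel : rel G := fun x y => (x != y) && (x + y \in H).

Definition sum_rel : rel G :=
  fun x y => (x != y) && (x + y \in H :\ (0 : G)).

Lemma ext_sum_rel_sym : symmetric ext_sum_rel.
Proof. by move=> x y; rewrite /ext_sum_rel eq_sym addrC. Qed.

Lemma ext_sum_rel_irrefl : irreflexive ext_sum_rel.
Proof. by move=> x; rewrite /ext_sum_rel eqxx. Qed.

Lemma sum_rel_sym : symmetric sum_rel.
Proof. by move=> x y; rewrite /sum_rel eq_sym addrC. Qed.

Lemma sum_rel_irrefl : irreflexive sum_rel.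
Proof. by move=> x; rewrite /sum_rel eqxx. Qed.

Definition ext_subgroup_sum_graph : sgraph G :=
  SGraph ext_sum_rel_sym ext_sum_rel_irrefl.

Definition subgroup_sum_graph : sgraph G :=
  SGraph sum_rel_sym sum_rel_irrefl.

(* s(H) *)
Definition num_sol2 : nat := #|[set x in H | x *+ 2 == 0]|.

(* The type of the coset H + a, given by a representative a; by the lemmas
   coset_typeN_rcoset below it depends only on the coset. *)
Definition coset_type1 a : bool := a *+ 2 \notin H.

Definition coset_type2 a : bool :=
  (a *+ 2 \in H) && ~~ [exists x in (H :* a)%g, x *+ 2 == 0].

Definition coset_type3 a : bool := [exists x in (H :* a)%g, x *+ 2 == 0].

Definition num_cosets (type : pred G) : nat :=
  #|[set (H :* a)%g | a : G & type a]|.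

Lemma rcoset_addE a : (H :* a)%g = [set h + a | h in H].
Proof.
by apply/setP=> x; apply/rcosetP/imsetP=> -[h hH ->]; exists h.
Qed.

Lemma coset_type1_rcoset a b : (H :* a)%g = (H :* b)%g ->
  coset_type1 a = coset_type1 b.
Proof.
move=> eab; have: a \in (H :* b)%g by rewrite -eab; exact: rcoset_refl.
rewrite rcoset_addE => /imsetP[h hH ->]; rewrite /coset_type1 mulrnDl.
by congr (~~ _); apply: groupMl; rewrite mulr2n; apply: groupM.
Qed.

Lemma coset_type2_rcoset a b : (H :* a)%g = (H :* b)%g ->
  coset_type2 a = coset_type2 b.
Proof.
move=> eab; have := coset_type1_rcoset eab; rewrite /coset_type1 /coset_type2 eab.
by move/negb_inj->.
Qed.

Lemma coset_type3_rcoset a b : (H :* a)%g = (H :* b)%g ->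
  coset_type3 a = coset_type3 b.
Proof. by rewrite /coset_type3 => ->. Qed.

End SubgroupSumGraphs.

(* Main.v *)
Require Import Defs.
From mathcomp Require Import all_boot all_order all_algebra all_fingroup.
From mathcomp Require Import zify ring.

Set Implicit Arguments.
Unset Strict Implicit.
Unset Printing Implicit Defensive.

Import GRing.Theory.
Local Open Scope ring_scope.

(** An edge [x, y] of either graph satisfies [x + y \in H], so that a vertex
    of the coset [H + a] has all its neighbours in [H - a]. When [2a \notin H]
    (Type 1) the cosets [H + a] and [H - a] differ and span a complete
    bipartite graph, minus the perfect matching [x -- -x] in the subgroup sum
    graph. When [2a \in H] (Types 2 and 3) the coset is closed under negation
    and spans a complete graph, minus the edges [x -- -x] with [2x <> 0] in the
    subgroup sum graph; such an [x] exists exactly when the coset has Type 2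
    or [s(H) < |H|] ([exists_doubling_neq0]).

    Independence numbers. Summing over all [a] in [G] gives
    [2 |H| |S| = \sum_a (|S :&: (H + a)| + |S :&: (H - a)|)]
    ([sum_card_opp_addcosets]), so it is enough to bound a summand by a weight
    depending only on the type of [a]: [|H|] for Type 1, and twice the
    independence number of the coset otherwise. The bound is attained by a set
    containing one whole coset of each pair [{H + a, H - a}] of Type 1 cosets
    and a largest independent set of each other coset. Both graphs are instances
    of [independence_number_coset_types].

    Clique numbers. A clique of either graph with at least three elements lies
    in a single coset of Type 2 or 3 ([ext_clique_cases]). In the extended graph
    this gives [|H|]. In the subgroup sum graph, a clique [S] in [H + a] meets
    [- S] only in solutions of [2x = 0], of which [H + a] has at most [s(H)], so
    [2 |S| = |S :|: - S| + |S :&: - S| <= |H| + s(H)]; choosing one element of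
    each pair [{x, -x}] of [H] gives equality. *)

(** * Cliques and independent sets *)

Lemma is_cliqueP (T : finType) (e : sgraph T) (S : {set T}) :
  reflect {in S &, forall x y, x != y -> e x y} (is_clique e S).
Proof.
apply: (iffP 'forall_in_'forall_in_implyP) => h x; first by move=> y hx hy; apply: h.
by move=> hx y hy; apply: h.
Qed.

Lemma is_independentP (T : finType) (e : sgraph T) (S : {set T}) :
  reflect {in S &, forall x y, ~~ e x y} (is_independent e S).
Proof.
apply: (iffP 'forall_in_forall_inP) => h x; first by move=> y hx hy; apply: h.
by move=> hx y hy; apply: h.
Qed.

Lemma bigmax_card_eq (T : finType) (P : pred {set T}) (S0 : {set T}) (n : nat) :
  P S0 -> #|S0| = n -> (forall S, P S -> (#|S| <= n)%N) ->
  (\max_(S : {set T} | P S) #|S|)%N = n.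
Proof.
move=> P0 <- ub; apply/eqP; rewrite eqn_leq (bigmax_sup S0) // andbT.
exact/bigmax_leqP.
Qed.

(** * Membership in subgroups and cosets, and coset types *)

(** The next lemmas restate in additive notation facts on the finite group
    underlying [G], whose multiplicative operations are convertible to the
    operations of the Z-module. *)

Lemma subgroup0 (G : finZmodType) (H : {group G}) : 0 \in H.
Proof. exact: (group1 H). Qed.

Lemma subgroupD (G : finZmodType) (H : {group G}) x y :
  x \in H -> y \in H -> x + y \in H.
Proof. exact: (@groupM _ H). Qed.

Lemma subgroupN (G : finZmodType) (H : {group G}) x : (- x \in H) = (x \in H).
Proof. exact: (groupV H x). Qed.

Lemma subgroupB (G : finZmodType) (H : {group G}) x y :
  x \in H -> y \in H -> x - y \in H.
Proof. by move=> hx hy; rewrite subgroupD ?subgroupN. Qed.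

Lemma subgroupDr (G : finZmodType) (H : {group G}) x y :
  y \in H -> (x + y \in H) = (x \in H).
Proof. exact: (@groupMr _ H y x). Qed.

Lemma mem_addcoset (G : finZmodType) (H : {group G}) x a :
  (x \in (H :* a)%g) = (x - a \in H).
Proof. exact: mem_rcoset. Qed.

Lemma addcoset_eq (G : finZmodType) (H : {group G}) x a :
  ((H :* x)%g == (H :* a)%g) = (x - a \in H).
Proof. by rewrite (sameP eqP rcoset_eqP) mem_addcoset. Qed.

(** A coset containing a solution of [2x = 0] doubles into [H], so that
    the elements [a] with [2a \in H] split into Types 2 and 3. *)
Lemma coset_type3E (G : finZmodType) (H : {group G}) a :
  coset_type3 H a = (a *+ 2 \in H) && ~~ coset_type2 H a.
Proof.
rewrite /coset_type2 -/(coset_type3 H a); case: (boolP (coset_type3 H a)).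
  case/exists_inP=> x; rewrite mem_addcoset => hx /eqP x2; rewrite andbF andbT.
  by rewrite -subgroupN -[- _]add0r -x2 -mulrnBl mulr2n subgroupD.
by rewrite andbT andbN.
Qed.

Lemma coset_type2_doubling_neq0 (G : finZmodType) (H : {group G}) a x :
  coset_type2 H a -> x \in (H :* a)%g -> x *+ 2 != 0.
Proof. by case/andP=> _ /exists_inPn h /h. Qed.

Lemma doubling_rcoset (G : finZmodType) (H : {group G}) a x :
  x \in (H :* a)%g -> (x *+ 2 \in H) = (a *+ 2 \in H).
Proof.
move/rcoset_eqP=> e; have := coset_type1_rcoset e.
by rewrite /coset_type1 => /negb_inj.
Qed.

(** Cosets of Types 2 and 3 are closed under negation. *)
Lemma addcosetN (G : finZmodType) (H : {group G}) a x :
  a *+ 2 \in H -> (- x \in (H :* a)%g) = (x \in (H :* a)%g).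
Proof.
move=> ha; rewrite !mem_addcoset -opprD subgroupN.
by rewrite -(subgroupDr (x - a) ha) mulr2n addrA subrK.
Qed.

(** The neighbours in the extended graph of a vertex in a coset of Type 2 or 3
    are the other elements of that coset. *)
Lemma add_mem_addcoset (G : finZmodType) (H : {group G}) a x y :
  a *+ 2 \in H -> x \in (H :* a)%g -> (x + y \in H) = (y \in (H :* a)%g).
Proof.
move=> ha; rewrite -(addcosetN x ha) => /rcoset_eqP <-.
by rewrite mem_addcoset opprK addrC.
Qed.

(** * Counting by cosets *)

(** Each coset has [|H|] representatives: summing the indicator of a property
    of cosets over all elements of [G] counts each coset [|H|] times. *)
Lemma card_num_cosets (G : finZmodType) (H : {group G}) (t : pred G) :
  (forall a b, (H :* a)%g = (H :* b)%g -> t a = t b) ->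
  (\sum_(a : G) t a = #|H| * num_cosets H t)%N.
Proof.
move=> tH; rewrite -big_mkcond /= /num_cosets.
rewrite (partition_big_imset (fun a => (H :* a)%g)) /=.
have -> : [set (H :* a)%g | a in t] = [set (H :* a)%g | a : G & t a].
  by apply/setP=> C; apply/imsetP/imsetP=> -[a ha ->]; exists a; rewrite ?inE // in ha *.
rewrite mulnC -sum_nat_const; apply: eq_bigr => C /imsetP[a].
rewrite inE => ta ->; rewrite -(card_rcoset H a) -sum1_card.
apply: eq_bigl => x; rewrite addcoset_eq mem_addcoset andbC.
case: (boolP (x - a \in H)) => //=; rewrite -addcoset_eq => /eqP/tH.
by rewrite unfold_in => ->; rewrite ta.
Qed.

Lemma sum_card_addcosets (G : finZmodType) (H : {group G}) (S : {set G}) :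
  (\sum_(a : G) #|S :&: (H :* a)%g| = #|H| * #|S|)%N.
Proof.
transitivity (\sum_(a : G) \sum_(x in S) ((x - a)%R \in H))%N.
  apply: eq_bigr => a _; rewrite -sum1_card big_mkcond [RHS]big_mkcond /=.
  by apply: eq_bigr => x _; rewrite inE mem_addcoset; case: (x \in S); case: (_ \in H).
rewrite exchange_big /= mulnC -sum_nat_const; apply: eq_bigr => x _.
rewrite -(card_rcoset H x) -sum1_card [RHS]big_mkcond /=; apply: eq_bigr => a _.
by rewrite mem_addcoset -subgroupN opprB; case: (_ \in H).
Qed.

(** The weight [d1], [d2] or [d3], according to the type of the coset of [a]. *)
Definition type_weight (G : finZmodType) (H : {group G}) (d1 d2 d3 : nat) (a : G) :=
  if coset_type1 H a then d1 else if coset_type2 H a then d2 else d3.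

Lemma sum_type_weight (G : finZmodType) (H : {group G}) d1 d2 d3 :
  (\sum_(a : G) type_weight H d1 d2 d3 a =
   #|H| * (d1 * num_cosets H (coset_type1 H) + d2 * num_cosets H (coset_type2 H)
           + d3 * num_cosets H (coset_type3 H)))%N.
Proof.
rewrite !mulnDr !(mulnCA #|H|).
rewrite -(card_num_cosets (@coset_type1_rcoset G H)).
rewrite -(card_num_cosets (@coset_type2_rcoset G H)).
rewrite -(card_num_cosets (@coset_type3_rcoset G H)).
rewrite !big_distrr -!big_split; apply: eq_bigr => a _ /=.
rewrite /type_weight coset_type3E /coset_type1 /coset_type2.
by case: (_ \in H); case: [exists x in _, _] => /=; rewrite ?muln0 ?muln1 ?addn0 ?add0n.
Qed.

Lemma sum_card_opp_addcosets (G : finZmodType) (H : {group G}) (S : {set G}) :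
  (\sum_(a : G) (#|S :&: (H :* a)%g| + #|S :&: (H :* (- a)%R)%g|)
   = #|H| * (2 * #|S|))%N.
Proof.
rewrite big_split /= sum_card_addcosets mulnCA mul2n -addnn; congr (_ + _)%N.
by rewrite -sum_card_addcosets [RHS](reindex_inj (@oppr_inj G)).
Qed.

Lemma double_card_leq_type_weight (G : finZmodType) (H : {group G}) (S : {set G}) d1 d2 d3 :
  (forall a, #|S :&: (H :* a)%g| + #|S :&: (H :* (- a)%R)%g|
             <= type_weight H d1 d2 d3 a)%N ->
  (2 * #|S| <= d1 * num_cosets H (coset_type1 H) + d2 * num_cosets H (coset_type2 H)
           + d3 * num_cosets H (coset_type3 H))%N.
Proof.
move=> h; rewrite -(leq_pmul2l (cardG_gt0 H)) -sum_card_opp_addcosets -sum_type_weight.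
exact: leq_sum.
Qed.

Lemma double_card_eq_type_weight (G : finZmodType) (H : {group G}) (S : {set G}) d1 d2 d3 :
  (forall a, #|S :&: (H :* a)%g| + #|S :&: (H :* (- a)%R)%g|
             = type_weight H d1 d2 d3 a)%N ->
  (2 * #|S| = d1 * num_cosets H (coset_type1 H) + d2 * num_cosets H (coset_type2 H)
           + d3 * num_cosets H (coset_type3 H))%N.
Proof.
move=> h; apply/eqP; rewrite -(eqn_pmul2l (cardG_gt0 H)) -sum_card_opp_addcosets.
by rewrite -sum_type_weight; apply/eqP/eq_bigr.
Qed.

(** * Independence numbers *)

(** In a complete bipartite graph between [H + a] and [H - a] minus the perfect
    matching [x -- -x], an independent set lies on one side, or is a pair
    [{x, -x}]; this is where [|H| > 1] is needed. *)
Lemma sum_graph_independent_type1 (G : finZmodType) (H : {group G}) (S : {set G}) a :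
  (1 < #|H|)%N -> is_independent (subgroup_sum_graph H) S -> coset_type1 H a ->
  (#|S :&: (H :* a)%g| + #|S :&: (H :* (- a)%R)%g| <= #|H|)%N.
Proof.
move=> H1 /is_independentP hS ta.
have opp x y : x \in S :&: (H :* a)%g -> y \in S :&: (H :* (- a)%R)%g -> y = - x.
  rewrite !inE !mem_addcoset opprK => /andP[xS xa] /andP[yS ya].
  have := hS x y xS yS; rewrite /= /sum_rel !inE.
  have -> : x + y \in H.
    by have := subgroupD xa ya; rewrite [y + a]addrC addrA subrK.
  have -> : x != y.
    apply: contraNneq ta => exy; rewrite exy in xa.
    have -> : a *+ 2 = (y + a) - (y - a) by rewrite opprB addrC addrA subrK mulr2n.
    exact: subgroupB.
  by rewrite andbT /= negbK addrC addr_eq0 => /eqP.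
have [->|[x xA]] := set_0Vmem (S :&: (H :* a)%g).
  by rewrite cards0 -(card_rcoset H (- a)) subset_leq_card ?subsetIr.
have [->|[y yB]] := set_0Vmem (S :&: (H :* (- a)%R)%g).
  by rewrite cards0 addn0 -(card_rcoset H a) subset_leq_card ?subsetIr.
apply: leq_trans H1; apply: (@leq_add _ _ 1 1).
  rewrite -(cards1 (- y)); apply/subset_leq_card/subsetP => z zA.
  by rewrite inE (opp z y zA yB) opprK.
rewrite -(cards1 (- x)); apply/subset_leq_card/subsetP => z zB.
by rewrite inE (opp x z xA zB).
Qed.

(** The independence number of a graph [e] between the subgroup sum graph and
    the extended one, when [d2] and [d3] are the independence numbers of its
    cosets of Types 2 and 3; [T] is an independent set that is simultaneously
    optimal on all these cosets. *)
Lemma independence_number_coset_types (G : finZmodType) (H : {group G})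
    (e : sgraph G) (T : {set G}) (d2 d3 : nat) :
  (1 < #|H|)%N ->
  subrel (subgroup_sum_graph H) e -> subrel e (ext_subgroup_sum_graph H) ->
  is_independent e T ->
  (forall a, a *+ 2 \in H ->
     #|T :&: (H :* a)%g| = if coset_type2 H a then d2 else d3) ->
  (forall (S : {set G}) a, is_independent e S -> a *+ 2 \in H ->
     (#|S :&: (H :* a)%g| <= if coset_type2 H a then d2 else d3)%N) ->
  (2 * independence_number e =
     #|H| * num_cosets H (coset_type1 H) + 2 * d2 * num_cosets H (coset_type2 H)
     + 2 * d3 * num_cosets H (coset_type3 H))%N.
Proof.
move=> H1 sub_e e_ext Tind cardT ub.
have oppE a : a *+ 2 \in H -> (H :* (- a)%R)%g = (H :* a)%g.
  move=> ha; apply/eqP; rewrite addcoset_eq.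
  by rewrite -subgroupN opprD !opprK -mulr2n.
(* Comparing the ranks of [H + x] and [H - x] selects one coset of each Type 1 pair. *)
pose rk (x : G) := enum_rank (H :* x)%g.
have rkN x a : (rk x == rk a) = (x - a \in H).
  by rewrite (inj_eq enum_rank_inj) addcoset_eq.
pose S := [set x | if coset_type1 H x then (rk x < rk (- x)%R)%N else x \in T].
have Sind : is_independent e S.
  apply/is_independentP => x y; rewrite !inE => xS yS; apply/negP => exy.
  have /andP[_ xyH] := e_ext _ _ exy.
  have exNy : rk x = rk (- y) by apply/eqP; rewrite rkN opprK.
  have eyNx : rk y = rk (- x) by apply/eqP; rewrite rkN opprK addrC.
  have txy : coset_type1 H x = coset_type1 H y.
    rewrite /coset_type1; congr (~~ _).
    have -> : x *+ 2 = (x + y) *+ 2 - y *+ 2 by rewrite mulrnDl addrK.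
    apply/idP/idP => h; last by rewrite subgroupB // mulr2n subgroupD.
    rewrite -[y *+ 2](subKr ((x + y) *+ 2)).
    by rewrite subgroupB // mulr2n subgroupD.
  move: xS yS; rewrite txy; case: ifP => _.
    by rewrite exNy eyNx => h1 h2; lia.
  by move=> xT yT; have /is_independentP/(_ x y xT yT) := Tind; rewrite exy.
have cardS := @double_card_eq_type_weight G H S #|H| (2 * d2) (2 * d3).
suff cardS2 : (2 * #|S| =
     #|H| * num_cosets H (coset_type1 H) + 2 * d2 * num_cosets H (coset_type2 H)
     + 2 * d3 * num_cosets H (coset_type3 H))%N.
  rewrite -cardS2; congr (2 * _)%N.
  apply: (@bigmax_card_eq _ (is_independent e) S) => // S' S'ind.
  rewrite -(@leq_pmul2l 2) // cardS2.
  apply: (@double_card_leq_type_weight G H S') => a; rewrite /type_weight.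
  case: ifP => ta.
    apply: sum_graph_independent_type1 => //.
    apply/is_independentP => x y xS yS; apply: contra (sub_e x y) _.
    by have /is_independentP := S'ind; apply.
  have ha : a *+ 2 \in H by move/negbFE: ta.
  rewrite oppE //; have := ub S' a S'ind ha.
  by case: ifP => _ h; rewrite mul2n -addnn; apply: leq_add; exact: h.
apply: cardS => a; rewrite /type_weight; case: ifP => ta; last first.
  have ha : a *+ 2 \in H by move/negbFE: ta.
  rewrite oppE //; suff -> : S :&: (H :* a)%g = T :&: (H :* a)%g.
    have := cardT a ha.
    by case: ifP => _ h; rewrite mul2n -addnn; exact: (f_equal2 addn h h).
  apply/setP => x; rewrite !inE.
  case: (boolP (x \in (H :* a)%g)) => [xa|]; rewrite ?andbF //.
  by rewrite /coset_type1 (doubling_rcoset xa) ha.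
have SI b : coset_type1 H b ->
    #|S :&: (H :* b)%g| = if (rk b < rk (- b)%R)%N then #|H| else 0%N.
  move=> tb; have mem x : x \in (H :* b)%g -> (x \in S) = (rk b < rk (- b)%R)%N.
    move=> xb; rewrite inE /coset_type1 (doubling_rcoset xb) -/(coset_type1 H b) tb.
    move: xb; rewrite mem_addcoset => xb.
    have -> : rk x = rk b by apply/eqP; rewrite rkN.
    by have -> : rk (- x) = rk (- b) by apply/eqP; rewrite rkN -opprD subgroupN.
  case: ifP => hb; rewrite hb in mem.
    rewrite -(card_rcoset H b); apply: eq_card => x; rewrite inE.
    by case: (boolP (x \in (H :* b)%g)) => [/mem->|]; rewrite ?andbF.
  apply: eq_card0 => x; rewrite inE.
  by case: (boolP (x \in (H :* b)%g)) => [/mem->|]; rewrite ?andbF.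
have tNa : coset_type1 H (- a) by rewrite /coset_type1 mulNrn subgroupN.
rewrite !SI // opprK.
have : rk a != rk (- a) by rewrite rkN opprK -mulr2n.
rewrite -val_eqE /= neq_ltn.
by case: ltngtP => // _ _; rewrite ?addn0.
Qed.

(** Cosets of Types 2 and 3 are complete in the extended graph, so a largest
    independent set of such a coset is any single element of it. *)
Lemma ext_independence_number (G : finZmodType) (H : {group G}) :
  (1 < #|H|)%N ->
  (2 * independence_number (ext_subgroup_sum_graph H) =
     #|H| * num_cosets H (coset_type1 H) + 2 * num_cosets H (coset_type2 H)
     + 2 * num_cosets H (coset_type3 H))%N.
Proof.
move=> H1; pose T := [set x : G | (x *+ 2 \in H) && (x == repr (H :* x)%g)].
rewrite (@independence_number_coset_types G H _ T 1 1) ?muln1 //.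
- by move=> x y /andP[xy /setD1P[_ xyH]]; apply/andP.
- apply/is_independentP => x y; rewrite !inE => /andP[x2 /eqP ex] /andP[_ /eqP ey].
  apply/negP => /andP[/eqP xy xyH]; case: xy; rewrite ex ey.
  by congr (repr _); apply/esym/rcoset_eqP; rewrite -(add_mem_addcoset y x2 (rcoset_refl H x)).
- move=> a ha; rewrite if_same.
  rewrite (_ : T :&: _ = [set repr (H :* a)%g]) ?cards1 //.
  apply/setP => x; rewrite !inE; apply/andP/eqP => [[/andP[_ /eqP ex] /rcoset_eqP <-]//|->].
  have ra := mem_repr_rcoset H a; split=> //.
  by rewrite (doubling_rcoset ra) ha; move/rcoset_eqP: ra => ->; rewrite eqxx.
move=> S a /is_independentP Sind ha; rewrite if_same.
have [->|[x]] := set_0Vmem (S :&: (H :* a)%g); first by rewrite cards0.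
rewrite inE => /andP[xS xa].
rewrite -(cards1 x); apply/subset_leq_card/subsetP => y /setIP[yS ya].
have := Sind x y xS yS; rewrite /= /ext_sum_rel.
by rewrite (add_mem_addcoset y ha xa) ya andbT negbK inE eq_sym.
Qed.

Lemma num_sol2_lt (G : finZmodType) (H : {group G}) :
  (num_sol2 H < #|H|)%N = [exists h in H, h *+ 2 != 0].
Proof.
have sub : [set x in H | x *+ 2 == 0] \subset H.
  by apply/subsetP => x; rewrite inE => /andP[].
rewrite /num_sol2 ltn_neqAle subset_leq_card // andbT (subset_leqif_cards sub).
apply/idP/exists_inP => [neq|[h hH h2]].
  have /subsetPn[h hH] : ~~ (H \subset [set x in H | x *+ 2 == 0]).
    by apply: contra neq => sub'; rewrite eqEsubset sub.
  by rewrite inE hH => h2; exists h.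
by apply: contra h2 => /eqP e; move: hH; rewrite -e inE => /andP[].
Qed.

(** In a coset of Type 3, which is a translate of [H] by a solution of
    [2x = 0], the elements with [2x <> 0] correspond to those of [H]. *)
Lemma exists_doubling_neq0 (G : finZmodType) (H : {group G}) a :
  a *+ 2 \in H ->
  [exists x in (H :* a)%g, x *+ 2 != 0] = coset_type2 H a || (num_sol2 H < #|H|)%N.
Proof.
move=> ha; have [t2|t2] := boolP (coset_type2 H a).
  by apply/exists_inP; exists a; rewrite ?rcoset_refl ?(coset_type2_doubling_neq0 t2) ?rcoset_refl.
have : coset_type3 H a by rewrite coset_type3E ha.
rewrite num_sol2_lt => /exists_inP[c]; rewrite mem_addcoset => ca /eqP c2.
apply/exists_inP/exists_inP => -[x].
  rewrite mem_addcoset => xa x2; exists (x - c); last by rewrite mulrnBl c2 subr0.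
  by have := subgroupB xa ca; rewrite opprB addrA subrK.
move=> xH x2; exists (x + c); last by rewrite mulrnDl c2 addr0.
by rewrite mem_addcoset -addrA subgroupD.
Qed.

Lemma addr_eq_opp (G : zmodType) (x : G) : (x == - x) = (x *+ 2 == 0).
Proof. by rewrite -addr_eq0 mulr2n. Qed.

(** In a coset of Type 2 or 3, the maximal independent sets of the subgroup sum
    graph are the sets [{x, -x}]. The boolean [num_sol2 H < #|H|] is read as a
    number, so that the independence number of a coset of Type 3 is 2 if
    [s(H) < |H|] and 1 if [s(H) = |H|]. *)
Lemma sum_independence_number (G : finZmodType) (H : {group G}) :
  (1 < #|H|)%N ->
  (2 * independence_number (subgroup_sum_graph H) =
     #|H| * num_cosets H (coset_type1 H) + 4 * num_cosets H (coset_type2 H)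
     + 2 * (num_sol2 H < #|H|).+1 * num_cosets H (coset_type3 H))%N.
Proof.
move=> H1.
(* [r C] is an element of the coset [C], with [2 (r C) <> 0] whenever possible. *)
pose r (C : {set G}) := odflt (repr C) [pick x in C | x *+ 2 != 0].
have r_mem a : r (H :* a)%g \in (H :* a)%g.
  by rewrite /r; case: pickP => [x /andP[]//|_]; apply: mem_repr_rcoset.
have r_eq a b : b \in (H :* a)%g -> r (H :* b)%g = r (H :* a)%g.
  by move/rcoset_eqP->.
have r_ex a : (r (H :* a)%g *+ 2 != 0) = [exists x in (H :* a)%g, x *+ 2 != 0].
  apply/idP/exists_inP => [h|[x xa x2]]; first by exists (r (H :* a)%g).
  by rewrite /r; case: pickP => [y /andP[]//|/(_ x)]; rewrite xa x2.
pose T := [set x : G | (x *+ 2 \in H) && ((x == r (H :* x)%g) || (x == - r (H :* x)%g))].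
have dE a : a *+ 2 \in H -> (if coset_type2 H a then 2 else (num_sol2 H < #|H|).+1)%N
    = [exists x in (H :* a)%g, x *+ 2 != 0].+1.
  by move=> ha; rewrite exists_doubling_neq0 //; case: ifP.
rewrite (@independence_number_coset_types G H _ T 2 (num_sol2 H < #|H|).+1) //.
- by move=> x y /andP[xy /setD1P[_ xyH]]; apply/andP.
- apply/is_independentP => x y; rewrite !inE => /andP[x2 ex] /andP[_ ey].
  apply/negP => /andP[xy /setD1P[xy0 xyH]].
  have yx : y \in (H :* x)%g by rewrite -(add_mem_addcoset y x2 (rcoset_refl H x)).
  rewrite (r_eq _ _ yx) in ey; move: xy xy0.
  by case/orP: ex => /eqP ->; case/orP: ey => /eqP ->; rewrite ?eqxx ?subrr ?addNr ?eqxx.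
- move=> a ha; rewrite dE // -r_ex -addr_eq_opp.
  rewrite (_ : T :&: _ = [set r (H :* a)%g; - r (H :* a)%g]).
    by rewrite cards2.
  apply/setP => x; rewrite !inE; apply/andP/idP => [[/andP[_ ex] /r_eq <-]//|ex].
  have xa : x \in (H :* a)%g by case/orP: ex => /eqP->; rewrite ?addcosetN.
  by rewrite (doubling_rcoset xa) ha (r_eq _ _ xa) ex.
move=> S a /is_independentP Sind ha; rewrite dE //.
have [->|[x]] := set_0Vmem (S :&: (H :* a)%g); first by rewrite cards0.
rewrite inE => /andP[xS xa].
apply: (@leq_trans #|[set x; - x]|).
  apply/subset_leq_card/subsetP => y /setIP[yS ya].
  have := Sind x y xS yS; rewrite /= /sum_rel !inE.
  by rewrite (add_mem_addcoset y ha xa) ya andbT negb_and !negbK eq_sym addrC addr_eq0.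
rewrite cards2 ltnS addr_eq_opp.
by case: (boolP (x *+ 2 != 0)) => //= x2; rewrite lt0b; apply/exists_inP; exists x.
Qed.

(** * Clique numbers *)

(** If [x], [y], [z] are distinct in a clique, then
    [2x = (x + y) + (z + x) - (y + z)] lies in [H]. *)
Lemma ext_clique_cases (G : finZmodType) (H : {group G}) (S : {set G}) :
  is_clique (ext_subgroup_sum_graph H) S ->
  (exists2 x, x *+ 2 \in H & S \subset (H :* x)%g) \/ (#|S| <= 2)%N.
Proof.
move/is_cliqueP => clS.
have sumH : {in S &, forall x y, x != y -> x + y \in H}.
  by move=> x y xS yS /(clS x y xS yS)/andP[].
have [|/card_gt2P[x [y [z [[xS yS zS] [xy yz zx]]]]]] := leqP #|S| 2; first by right.
have x2 : x *+ 2 \in H.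
  have -> : x *+ 2 = (x + y) + (z + x) - (y + z).
    by rewrite [z + x]addrC addrACA addrK mulr2n.
  by apply: subgroupB; [apply: subgroupD|]; apply: sumH.
left; exists x => //; apply/subsetP => u uS; rewrite mem_addcoset.
have [->|ux] := eqVneq u x; first by rewrite subrr subgroup0.
by have := subgroupB (sumH u x uS xS ux) x2; rewrite mulr2n opprD addrA addrK.
Qed.

Lemma ext_clique_number (G : finZmodType) (H : {group G}) :
  (1 < #|H|)%N -> clique_number (ext_subgroup_sum_graph H) = #|H|.
Proof.
move=> H1; apply: (@bigmax_card_eq _ _ (H : {set G})) => //.
  by apply/is_cliqueP => x y xH yH xy; rewrite /= /ext_sum_rel xy subgroupD.
move=> S /ext_clique_cases[[x _ sub]|/leq_trans->//].
by rewrite -(card_rcoset H x) subset_leq_card.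
Qed.

Lemma mem_oppset (G : finZmodType) (S : {set G}) x :
  (x \in [set - y | y in S]) = (- x \in S).
Proof. by rewrite -{1}[x]opprK mem_imset //; apply: oppr_inj. Qed.

Lemma card_setU_opp (G : finZmodType) (S : {set G}) :
  (#|S :|: [set (- y)%R | y in S]| + #|S :&: [set (- y)%R | y in S]| = 2 * #|S|)%N.
Proof. by rewrite cardsUI card_imset ?mul2n ?addnn //; apply: oppr_inj. Qed.

Lemma card_sol2_rcoset (G : finZmodType) (H : {group G}) a :
  (#|[set y in (H :* a)%g | y *+ 2 == 0%R]| <= num_sol2 H)%N.
Proof.
have [->|[c]] := set_0Vmem [set y in (H :* a)%g | y *+ 2 == 0]; first by rewrite cards0.
rewrite inE mem_addcoset => /andP[ca /eqP c2].
rewrite -(card_imset (f := fun y : G => y - c) _ (@addIr G (- c))).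
apply/subset_leq_card/subsetP => _ /imsetP[y + ->].
rewrite inE mem_addcoset => /andP[ya /eqP y2].
rewrite inE mulrnDl y2 mulNrn c2 oppr0 addr0 eqxx andbT.
by have := subgroupB ya ca; rewrite opprB addrA subrK.
Qed.

Lemma sum_clique_number (G : finZmodType) (H : {group G}) :
  (1 < #|H|)%N ->
  (2 * clique_number (subgroup_sum_graph H) = #|H| + num_sol2 H)%N.
Proof.
move=> H1.
(* [S0] contains one element of each pair [{x, -x}] in [H]. *)
pose S0 := [set x in H | (enum_rank x <= enum_rank (- x)%R)%N].
have cardS0 : (2 * #|S0| = #|H| + num_sol2 H)%N.
  rewrite -card_setU_opp; congr (_ + _)%N; apply: eq_card => x.
    rewrite in_setU mem_oppset !inE subgroupN opprK -andb_orr.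
    by case/orP: (leq_total (enum_rank x) (enum_rank (- x))) => ->; rewrite ?orbT andbT.
  rewrite in_setI mem_oppset !inE subgroupN opprK -andbACA andbb -eqn_leq.
  by rewrite val_eqE (inj_eq enum_rank_inj) addr_eq_opp.
have sol1 : (0 < num_sol2 H)%N.
  by apply/card_gt0P; exists 0; rewrite inE subgroup0 mul0rn eqxx.
rewrite -cardS0; congr (2 * _)%N; apply: (@bigmax_card_eq _ _ S0) => //.
  apply/is_cliqueP => x y; rewrite !inE => /andP[xH xr] /andP[yH yr] xy.
  rewrite /= /sum_rel xy !inE subgroupD // andbT; apply: contraNneq xy => xy0.
  have exy : y = - x by apply/eqP; rewrite -addr_eq0 addrC xy0.
  move: yr xr; rewrite exy opprK => yr xr.
  by apply/eqP/enum_rank_inj/val_inj/eqP; rewrite eqn_leq /= yr xr.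
move=> S clS; rewrite -(@leq_pmul2l 2) //.
have : is_clique (ext_subgroup_sum_graph H) S.
  apply/is_cliqueP => x y xS yS xy; move/is_cliqueP/(_ x y xS yS xy): clS.
  by case/andP=> _ /setD1P[_ xyH]; apply/andP.
case/ext_clique_cases => [[x x2 sub]|S2]; last first.
  (* As [0] is a solution, [2 |S0| = |H| + s(H) >= 3], and so [|S0| >= 2] by parity. *)
  rewrite leq_mul2l /=; apply: leq_trans S2 _.
  have : (2 + 1 <= 2 * #|S0|)%N by rewrite cardS0; apply: leq_add.
  by case: #|S0| => [|[]].
rewrite cardS0 -card_setU_opp leq_add //.
  rewrite -(card_rcoset H x); apply/subset_leq_card/subsetP => y.
  by rewrite in_setU mem_oppset => /orP[] /(subsetP sub); rewrite ?addcosetN.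
apply: leq_trans (card_sol2_rcoset H x); apply/subset_leq_card/subsetP => y.
rewrite in_setI mem_oppset inE => /andP[yS NyS]; rewrite (subsetP sub) //=.
rewrite -addr_eq_opp; apply/negPn/negP => yNy.
move/is_cliqueP/(_ y (- y) yS NyS yNy): clS.
by rewrite /= /sum_rel subrr !inE eqxx andbF.
Qed.

(** * The clique and independence numbers of both graphs *)

Theorem theorem5p1 (G : finZmodType) (H : {group G})
    (H_neq0 : H :!=: [set (0 : G)]) (H_neqG : H :!=: [set: G])
    (k m m1 m2 m3 : nat)
    (hk : #|H| = k) (hm : #|([set: G] / H)%g| = m)
    (hm1 : num_cosets H (coset_type1 H) = m1)
    (hm2 : num_cosets H (coset_type2 H) = m2)
    (hm3 : num_cosets H (coset_type3 H) = m3) :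
  [/\ clique_number (ext_subgroup_sum_graph H) = k /\
      (independence_number (ext_subgroup_sum_graph H))%:R
        = k%:R * m1%:R / 2%:R + m2%:R + m3%:R :> rat,
      (clique_number (subgroup_sum_graph H))%:R
        = (k%:R + (num_sol2 H)%:R) / 2%:R :> rat
    & ((num_sol2 H < #|H|)%N ->
        (independence_number (subgroup_sum_graph H))%:R
          = k%:R * m1%:R / 2%:R + 2%:R * (m2%:R + m3%:R) :> rat) /\
      (num_sol2 H = #|H| ->
        (independence_number (subgroup_sum_graph H))%:R
          = k%:R * m1%:R / 2%:R + 2%:R * m2%:R + m3%:R :> rat)].
Proof.
have H1 : (1 < #|H|)%N by rewrite (cardG_gt1 H).
have halve (n p : nat) : (2 * n = p)%N -> n%:R = p%:R / 2%:R :> rat.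
  by move=> <-; rewrite natrM mulrC mulKf.
have := halve _ _ (sum_independence_number H1).
rewrite (halve _ _ (ext_independence_number H1)) (halve _ _ (sum_clique_number H1)).
rewrite hk hm1 hm2 hm3 !natrD !natrM => sumE.
split; [split=> [|]; first by rewrite ext_clique_number | by [] |].
  by field.
by split=> s; rewrite sumE; [rewrite s | rewrite s ltnn] => /=; field.
Qed.
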